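(* Let $n\ge 2$, $m\geq 1$ and $k\geq 0$ be integers with $km \leq n-1$. The number of prime parking functions of length $n$ with exactly $k$ $m$-cycles is $$\sum_{\substack{\ell\ge 0\\ (k+\ell)m \leq n-1}} (-1)^{\ell}\, \frac{\left((m-1)!\right)^{k+\ell}}{k!\,\ell!} \binom{n-1}{m, \dots, m,\, n-(k+\ell)m-1} (n-1)^{n-(k+\ell)m-1},$$ where in the multinomial coefficient the entry $m$ is repeated $k+\ell$ times.
   Context: A parking function of length $n$ is a sequence $\pi=(\pi_1,\dots,\pi_n)$ of positive integers such that, if $\lambda_1\le\cdots\le\lambda_n$ is the weakly increasing rearrangement of $\pi_1,\dots,\pi_n$, then $\lambda_i\le i$ for all $1\le i\le n$. A parking function $\pi$ of length $n$ is prime if for all $1\le j\le n-1$ one has $\#\{i: \pi_i\le j\}\ge j+1$. For $m\ge 1$, distinct indices $(i_1,\dots,i_m)$ in $\{1,\dots,n\}$ form an $m$-cycle of $\pi$ if $\pi_{i_1}=i_2,\ \pi_{i_2}=i_3,\dots,\pi_{i_{m-1}}=i_m,\ \pi_{i_m}=i_1$; tuples that differ by a cyclic rotation are regarded as the same $m$-cycle. For $m=1$ an $m$-cycle is a fixed point, i.e. an index $i$ with $\pi_i=i$. The multinomial coefficient with $k+\ell$ entries equal to $m$ is $\binom{n-1}{m,\dots,m,\,n-(k+\ell)m-1}=\frac{(n-1)!}{(m!)^{k+\ell}\,(n-(k+\ell)m-1)!}$. *)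

(* Defs.v *)
From mathcomp Require Import all_boot all_order all_algebra.

Set Implicit Arguments.
Unset Strict Implicit.
Unset Printing Implicit Defensive.

(* A sequence (pi_1, ..., pi_n) is a function pi on 'I_n: the index i : 'I_n   *)
(* stands for the position i.+1, while the values of pi are not shifted.       *)

Definition parking n (pi : 'I_n -> nat) : bool :=
  [forall i, 0 < pi i] &&
  [forall i : 'I_n, nth 0 (sort leq [seq pi j | j : 'I_n]) i <= i.+1].

Definition prime_parking n (pi : 'I_n -> nat) : bool :=
  parking pi && [forall j : 'I_n, (0 < j) ==> (j.+1 <= #|[set i | pi i <= j]|)].

Definition is_mcycle n m (pi : 'I_n -> nat) (c : m.-tuple 'I_n) : bool :=
  uniq c && cycle [rel i j : 'I_n | pi i == j.+1] c.

Definition rotation_of n m : rel (m.-tuple 'I_n) :=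
  [rel c d : m.-tuple 'I_n | [exists r : 'I_m, d == [tuple of rot r c]]].

Definition num_mcycles n m (pi : 'I_n -> nat) : nat :=
  #|equivalence_partition (@rotation_of n m)
      [set c : m.-tuple 'I_n | is_mcycle pi c]|.

(* The terms of a parking function of length n are at most n (see             *)
(* parking_le), so it suffices to let pi range over functions into 'I_n.+1.    *)
Definition prime_parking_with_mcycles n m k : {set {ffun 'I_n -> 'I_n.+1}} :=
  [set pi : {ffun 'I_n -> 'I_n.+1} |
    prime_parking (fun i => pi i : nat)
    && (num_mcycles m (fun i => pi i : nat) == k)].

Definition multinomial (s : seq nat) : rat :=
  (((sumn s)`!)%:R / (\prod_(a <- s) a`!)%:R)%R.

Lemma parking_le n (pi : 'I_n -> nat) (i : 'I_n) : parking pi -> pi i <= n.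
Proof.
case/andP=> _ /forallP le_sort.
set s := [seq pi j | j : 'I_n] in le_sort.
have : pi i \in sort leq s by rewrite mem_sort; apply: image_f.
case/(nthP 0)=> j; rewrite size_sort size_image card_ord => lt_jn <-.
exact: leq_trans (le_sort (Ordinal lt_jn)) lt_jn.
Qed.

(* Main.v *)
Require Import Defs.
From mathcomp Require Import all_boot all_order all_algebra.
From mathcomp Require Import perm zify ring.

Set Implicit Arguments.
Unset Strict Implicit.
Unset Printing Implicit Defensive.

(* If c(pi) is the number of m-cycles of pi, then c(c-1)...(c-s+1) m^s counts   *)
(* the injective arrays f(a, b), a < s, b < m, whose rows are m-cycles of pi.   *)
(* Summed over prime parking functions pi, this counts pairs (pi, f).  Since    *)
(* primality is invariant under permuting positions, the positions f(a, b) can  *)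
(* be moved to fixed places; the moved function then takes distinct values      *)
(* there, and these values determine f.  A cyclic shift argument modulo n-1     *)
(* (Raney's lemma: each shift class contains exactly one prime word) gives      *)
(* (n-1)_{sm} (n-1)^{n-1-sm} such functions.  Binomial inversion then passes    *)
(* from these factorial moments to the number of pi with exactly k m-cycles.    *)

(** Write n = p + 2. Primality forces all values into 1..n-1, so subtracting one turns prime parking
    functions into words v over Z/(n-1) ([card_prime_parking_with_mcycles]). With c(v) the number of
    m-cycles, [card_cycle_systems] reads c(v)^_s m^s as a number of injective arrays,
    [sum_card_prime_systems] moves their positions to fixed places, and [card_prime_word_inj_on],
    through the cycle lemma [sum_prime_shift], counts the remaining words. For sm <= n-1 the sum of
    C(c(v), s) over prime v is therefore (n-1)! (n-1)^(n-1-sm) / (s! m^s (n-1-sm)!).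

    The indicator of c = k is the alternating sum over l of C(k+l, k) C(c, k+l)
    ([binomial_inversion_indicator]). Summing over v with s = k+l gives the formula, since C(k+l, k)
    / (k+l)! = 1 / (k! l!) and 1 / m^s = ((m-1)!)^s / (m!)^s. *)

Lemma cycle_tnth (T : Type) (e : rel T) m (c : m.-tuple T) :
  cycle e c = [forall b, e (tnth c b) (tnth c (ordS b))].
Proof.
case: m c => [|m] c; first by rewrite (tuple0 c); apply/esym/forallP => -[].
case/tupleP: c => x s; rewrite /cycle.
apply/(pathP x)/forallP => [H b|H i].
  rewrite !(tnth_nth x) /=.
  have := H b; rewrite size_rcons size_tuple ltn_ord => /(_ isT).
  rewrite -rcons_cons nth_rcons /= size_tuple ltn_ord nth_rcons size_tuple.
  case: ltngtP => [ltbm||->]; last by rewrite modnn.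
    by rewrite modn_small.
  by rewrite ltnNge -ltnS ltn_ord.
rewrite size_rcons size_tuple => lti; have := H (Ordinal lti).
rewrite !(tnth_nth x) /= -rcons_cons nth_rcons /= size_tuple lti nth_rcons.
rewrite size_tuple; case: ltngtP => [ltbm||->]; last by rewrite modnn.
  by rewrite modn_small.
by rewrite ltnNge -ltnS lti.
Qed.

Lemma eq_num_mcycles n m (pi pi' : 'I_n -> nat) :
  pi =1 pi' -> num_mcycles m pi = num_mcycles m pi'.
Proof.
move=> eq_pi; rewrite /num_mcycles.
suff -> : [set c : m.-tuple 'I_n | is_mcycle pi c]
          = [set c | is_mcycle pi' c] by [].
apply/setP => c; rewrite !inE /is_mcycle; congr (_ && _).
by apply: eq_cycle => i j /=; rewrite eq_pi.
Qed.

Lemma is_mcycle_succ n m (F : 'I_n -> 'I_n) (c : m.-tuple 'I_n) :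
  is_mcycle (fun i => (F i).+1) c = uniq c && fcycle F c.
Proof. by congr (_ && _); apply: eq_cycle => i j /=; rewrite eqSS. Qed.

Lemma rotation_of_mem n m (c d : m.-tuple 'I_n) : rotation_of c d -> c =i d.
Proof. by case/existsP => r /eqP-> x; rewrite mem_rot. Qed.

Lemma rotation_of_rot n m (c d : m.-tuple 'I_n) i :
  0 < m -> i <= m -> val d = rot i c -> rotation_of c d.
Proof.
move=> m_gt0 le_im def_d; apply/existsP.
have [lt_im|] := ltnP i m.
  by exists (Ordinal lt_im); apply/eqP/val_inj.
move=> ge_im; exists (Ordinal m_gt0); apply/eqP/val_inj.
by rewrite /= rot0 def_d rot_oversize ?size_tuple.
Qed.

(** A cycle of [F] through [x] is a rotation of the orbit of [x], so two cycles with a common entry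
    are rotations of each other. *)
Lemma rotation_of_share n m (F : 'I_n -> 'I_n) (c d : m.-tuple 'I_n) x :
  uniq c && fcycle F c -> uniq d && fcycle F d -> x \in c -> x \in d ->
  rotation_of c d.
Proof.
case/andP=> Uc Fc /andP[Ud Fd] xc xd.
have le_m (e : m.-tuple 'I_n) : index x e <= m.
  by have := index_size x e; rewrite size_tuple.
have m_gt0 : 0 < m.
  by case: (m) c xc {Uc Fc le_m} d Ud Fd xd => // c; rewrite (tuple0 c).
have := orbitE Fd Ud xd; rewrite (orbitE Fc Uc xc) => /(canLR (rotK _)).
rewrite /rotr size_rot rot_add_mod ?size_tuple ?leq_subr //.
move=> def_d; apply: rotation_of_rot (esym def_d) => //.
by case: ifP => // _; rewrite leq_subLR leq_add ?leq_subr.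
Qed.

(** By [rotation_of_share], being a rotation amounts on [D] to having the same entries, hence is an
    equivalence there. A class is the set of the m rotations of any of its members. *)
Lemma rotation_classes n m (F : 'I_n -> 'I_n)
    (D := [set c : m.-tuple 'I_n | is_mcycle (fun i => (F i).+1) c]) :
  0 < m ->
  let P := equivalence_partition (@rotation_of n m) D in
  [/\ partition P D, {in P, forall A : {set m.-tuple 'I_n}, #|A| = m}
    & {in D &, forall c d, (d \in pblock P c) = rotation_of c d}].
Proof.
move=> m_gt0.
have DE c : (c \in D) = (uniq c && fcycle F c).
  by rewrite inE is_mcycle_succ.
have hd (c : m.-tuple 'I_n) : exists x, x \in c.
  by exists (tnth c (Ordinal m_gt0)); apply: mem_tnth.
have rotE c d : c \in D -> d \in D -> reflect (c =i d) (rotation_of c d).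
  rewrite !DE => Dc Dd; apply: (iffP idP) => [/rotation_of_mem //|eq_cd].
  by have [x xc] := hd c; apply: (rotation_of_share Dc Dd xc); rewrite -eq_cd.
have equivR : {in D & &, equivalence_rel (@rotation_of n m)}.
  move=> c d e Dc Dd De; split; first by apply/rotE.
  move/(rotE _ _ Dc Dd) => eq_cd.
  by apply/rotE/rotE => // eq_e x; rewrite -?eq_cd -?eq_e // eq_cd.
move=> P; have partP : partition P D by apply: equivalence_partitionP.
split=> //; last by move=> c d Dc Dd; rewrite pblock_equivalence_partition.
move=> A PA; have [x Ax] : exists x, x \in A.
  by apply/set0Pn; apply: contraTneq PA => ->; case/and3P: partP.
have sAD : A \subset D by rewrite -(cover_partition partP) (bigcup_max A).
have tiP : trivIset P by case/and3P: partP.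
have Dx := subsetP sAD x Ax; have := Dx; rewrite DE => /andP[Ux Fx].
rewrite -[RHS]card_ord.
have <- : [set [tuple of rot r x] | r : 'I_m] = A.
  apply/setP => d; have AE : (d \in D -> (d \in A) = rotation_of x d).
    move=> Dd; rewrite -(pblock_equivalence_partition equivR) //.
    by rewrite (def_pblock tiP PA Ax).
  apply/imsetP/idP => [[r _ def_d]|Ad].
    have Dd : d \in D by rewrite DE def_d rot_uniq Ux rot_cycle.
    by rewrite AE //; apply/existsP; exists r; apply/eqP.
  have := Ad; rewrite AE ?(subsetP sAD) // => /existsP[r /eqP->].
  by exists r.
(* The rotation by r starts with entry r of [x], and the entries of [x] are distinct, so different r
   give different tuples. *)
rewrite card_imset // => r1 r2 /(congr1 val) /= eq_rot.
apply: val_inj; have r_lt (r : 'I_m) : r < size x by rewrite size_tuple.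
pose y := tnth x (Ordinal m_gt0).
have nth_r (r : 'I_m) : nth y (rot r x) 0 = nth y x r.
  by rewrite nth_cat size_drop subn_gt0 r_lt nth_drop addn0.
have := nth_r r1; rewrite eq_rot nth_r => /eqP.
by rewrite nth_uniq // => /eqP.
Qed.

Lemma card_dependent_family (I T : finType) (A : I -> {set T}) :
  #|[set f : {ffun I -> T} | [forall i, f i \in A i]]| = \prod_i #|A i|.
Proof.
transitivity #|family (fun i => mem (A i))|.
  by apply: eq_card => f; rewrite inE; apply/forallP/familyP => Hf i; apply: Hf.
by rewrite card_family foldrE big_image.
Qed.

(** The rows of such an array are cycles of [F], and injectivity says that they lie in distinct
    rotation classes, because cycles sharing an entry are rotations. Choosing the classes in order
    gives the falling factorial; choosing a representative of each gives m^s. *)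
Lemma card_cycle_systems n m s (F : 'I_n -> 'I_n) :
  0 < m ->
  #|[set f : {ffun 'I_s * 'I_m -> 'I_n} |
      injectiveb f && [forall x, F (f x) == f (x.1, ordS x.2)]]|
  = num_mcycles m (fun i => (F i).+1) ^_ s * m ^ s.
Proof.
move=> m_gt0; have [] := rotation_classes F m_gt0.
rewrite /num_mcycles; set D := [set c | _]; set P := equivalence_partition _ _.
move=> partP sizeP blockE; have [_ tiP _] := and3P partP.
have DE c : (c \in D) = (uniq c && fcycle F c) by rewrite inE is_mcycle_succ.
pose H := [set h : {ffun 'I_s -> m.-tuple 'I_n} |
  [forall a, h a \in D] && injectiveb (fun a => pblock P (h a))].
pose phi (h : {ffun 'I_s -> m.-tuple 'I_n}) : {ffun 'I_s * 'I_m -> 'I_n} :=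
  [ffun x => tnth (h x.1) x.2].
have phi_inj : injective phi.
  move=> h1 h2 /ffunP eq_phi; apply/ffunP => a; apply: eq_from_tnth => b.
  by have := eq_phi (a, b); rewrite !ffunE.
have -> : [set f : {ffun 'I_s * 'I_m -> 'I_n} |
    injectiveb f && [forall x, F (f x) == f (x.1, ordS x.2)]] = phi @: H.
  apply/setP => f; rewrite inE.
  apply/andP/imsetP => [[/injectiveP injf /forallP Ff]|].
    pose h : {ffun 'I_s -> m.-tuple 'I_n} :=
      [ffun a => [tuple f (a, b) | b < m]].
    have def_f : f = phi h by apply/ffunP=> -[a b]; rewrite !ffunE tnth_mktuple.
    have Dh a : h a \in D.
      rewrite DE ffunE; apply/andP; split.
        rewrite map_inj_uniq ?enum_uniq // => b1 b2 /injf; by case.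
      rewrite cycle_tnth; apply/forallP => b /=.
      by rewrite !tnth_mktuple; exact: (Ff (a, b)).
    exists h => //; rewrite inE; apply/andP; split; first exact/forallP.
    apply/injectiveP => a1 a2 eq_a.
    have : h a2 \in pblock P (h a1).
      by rewrite eq_a mem_pblock (cover_partition partP).
    rewrite blockE // => /rotation_of_mem/(_ (tnth (h a2) (Ordinal m_gt0))).
    rewrite mem_tnth => /tnthP[b].
    by rewrite !ffunE !tnth_mktuple => /injf[].
  case=> h; rewrite inE => /andP[/forallP Dh /injectiveP injh] ->; split.
    apply/injectiveP => -[a1 b1] [a2 b2]; rewrite !ffunE /= => eq_t.
    have eq_a : a1 = a2.
      apply: injh; apply: same_pblock => //.
      rewrite blockE //; have := Dh a1; have := Dh a2; rewrite !DE => D2 D1.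
      apply: (rotation_of_share D2 D1 (mem_tnth b2 _)).
      by rewrite -eq_t mem_tnth.
    move: eq_t; rewrite eq_a => eq_t; congr (_, _); apply/eqP.
    by have := Dh a2; rewrite DE => /andP[/tuple_uniqP Uh _]; apply/eqP/Uh.
  apply/forallP => -[a b]; rewrite !ffunE.
  by have := Dh a; rewrite DE cycle_tnth => /andP[_ /forallP/(_ b)].
rewrite card_imset // -sum1_card.
pose cls (h : {ffun 'I_s -> m.-tuple 'I_n}) := [ffun a => pblock P (h a)].
pose G := [set g : {ffun 'I_s -> {set m.-tuple 'I_n}} in ffun_on (mem P) |
  injectiveb g].
(* Choices of rows are grouped by their injective family [g] of classes; the fibre over [g] is the
   product of the sets [g a], each of size m. *)
rewrite (partition_big cls (mem G)) /=; last first.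
  move=> h; rewrite !inE => /andP[/forallP Dh /injectiveP injh].
  apply/andP; split.
    by apply/ffun_onP => a; rewrite ffunE pblock_mem // (cover_partition partP).
  by apply/injectiveP => a1 a2; rewrite !ffunE => /injh.
rewrite (eq_bigr (fun _ => m ^ s)).
  by rewrite sum_nat_const card_inj_ffuns_on card_ord.
move=> g; rewrite inE => /andP[/ffun_onP Pg /injectiveP injg].
rewrite sum1dep_card.
transitivity
  #|[set h : {ffun 'I_s -> m.-tuple 'I_n} | [forall a, h a \in g a]]|.
  apply: eq_card => h; rewrite !inE; apply/andP/forallP.
    case=> /andP[/forallP Dh _] /eqP/ffunP eq_g a.
    by rewrite -eq_g ffunE mem_pblock (cover_partition partP).
  move=> gh; have cls_h a : pblock P (h a) = g a.
    by apply: def_pblock => //; apply: Pg.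
  split; last by apply/eqP/ffunP => a; rewrite ffunE.
  apply/andP; split; last by apply/injectiveP => a1 a2; rewrite !cls_h => /injg.
  apply/forallP => a; rewrite -(cover_partition partP).
  by apply/bigcupP; exists (g a).
rewrite card_dependent_family (eq_bigr (fun _ => m)) ?prod_nat_const ?card_ord //.
by move=> a _; apply: sizeP; apply: Pg.
Qed.

(* Primality of [pi = v + 1]; a prime parking function of length [p + 2] has *)
(* its values in {1, ..., p + 1}, so that [v] takes values in Z/(p + 1).     *)
Definition prime_word (I : finType) p (v : I -> 'I_p.+1) : bool :=
  [forall j : 'I_p.+1, j.+1 < #|[set i | v i <= j]|].

(** * The cycle lemma for words over Z/(p+1) *)

Section CycleLemma.
Variables (I : finType) (p : nat) (v : I -> 'I_p.+1).
Hypothesis card_I : #|I| = p.+2.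

(** Cumulative count of letters along the periodic unrolling of Z/(p+1): [inZp] lets [j] run past
    [p.+1], so that cyclic intervals become ordinary ones. *)
Let T j := \sum_(x < j) #|[set i | v i == inZp x]|.

Let T_add (c : 'I_p.+1) k : k <= p.+1 ->
  T (c + k) = T c + #|[set i | (v i - c)%R < k]|.
Proof.
elim: k => [|k IHk] le_kp.
  rewrite addn0 [X in _ + X](_ : _ = 0) ?addn0 //.
  by apply: eq_card0 => i; rewrite inE.
rewrite addnS {1}/T big_ord_recr /= -/(T _) IHk 1?ltnW // -addnA; congr (_ + _).
rewrite -(cardsID [set i | (v i - c)%R < k] [set i | (v i - c)%R < k.+1]).
congr (_ + _); apply: eq_card => i; rewrite !inE.
  by apply/idP/andP => [lt_k|[]//]; split=> //; apply: leqW.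
have -> : inZp (c + k) = (c + inZp k)%R :> 'I_p.+1.
  by apply: val_inj; rewrite /= modnDmr.
rewrite GRing.addrC -GRing.subr_eq -val_eqE [val (inZp k)]modn_small //.
by rewrite -leqNgt ltnS eqn_leq andbC.
Qed.

Let T_period (c : 'I_p.+1) : T (c + p.+1) = T c + p.+2.
Proof.
rewrite T_add //; congr (_ + _); rewrite -card_I; apply: eq_card => i.
by rewrite !inE ltn_ord.
Qed.

(** In terms of the walk T j - j: the shift by [c] is prime when the walk stays strictly above its
    value at [c] for one full period. *)
Let prime_shiftP (c : 'I_p.+1) :
  reflect (forall k, 0 < k <= p.+1 -> T c + k < T (c + k))
    (prime_word (fun i => v i - c)%R).
Proof.
apply: (iffP forallP) => [good k /andP[k_gt0 le_kp]|good j].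
  rewrite T_add // ltn_add2l; case: k k_gt0 le_kp => // k _ lt_kp.
  by have := good (Ordinal lt_kp).
by have := good j.+1; rewrite T_add ?ltn_ord // ltn_add2l; apply.
Qed.

Lemma sum_prime_shift : \sum_(c : 'I_p.+1) prime_word (fun i => v i - c)%R = 1.
Proof.
(* The good shift is the last minimizer of [T j - j]. *)
pose U (j : 'I_p.+1) := T j + p.+1 - j.
have [c0 _ U_min] := @arg_minnP _ ord0 xpredT U isT.
have [c /eqP Uc c_max] := @arg_maxnP _ c0 (fun j => U j == U c0) val (eqxx _).
have good_c : prime_word (fun i => v i - c)%R.
  apply/prime_shiftP => k /andP[k_gt0 le_kp].
  have [lt_ck|ge_ck] := ltnP (c + k) p.+1.
    have := U_min (Ordinal lt_ck) isT; have := c_max (Ordinal lt_ck).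
    by case: eqP => [_ /(_ isT)|]; rewrite -?Uc /U /= ?leqE; lia.
  (* Past the end of the period the walk has gained one ([T_period]), so weak minimality at the
     wrapped position already gives a strict inequality. *)
  have lt_e : c + k - p.+1 < p.+1 by have := ltn_ord c; lia.
  have := U_min (Ordinal lt_e) isT; have := T_period (Ordinal lt_e).
  rewrite -Uc /U /= subnK //; have := ltn_ord c; lia.
rewrite (bigD1 c) //= good_c big1 ?addn0 // => d ne_dc.
apply/eqP; rewrite eqb0; apply: contra ne_dc => good_d; apply/eqP.
(* Two good shifts x < y would make the walk rise from x to y and again from y to x + p + 1, by at
   least two in all, whereas it gains exactly one per period. *)
have no_lt (x y : 'I_p.+1) : prime_word (fun i => v i - x)%R ->
    prime_word (fun i => v i - y)%R -> ~ x < y.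
  move=> /prime_shiftP good_x /prime_shiftP good_y lt_xy.
  have lt_y := ltn_ord y; have := T_period x.
  have := good_x (y - x); have := good_y (p.+1 - (y - x)).
  have -> : y + (p.+1 - (y - x)) = x + p.+1 by lia.
  have -> : x + (y - x) = y by lia.
  lia.
apply: val_inj => /=; have := no_lt _ _ good_c good_d.
by have := no_lt _ _ good_d good_c; lia.
Qed.

End CycleLemma.

(** * Words with distinct letters at given positions *)

Lemma card_ffun_inj_on (I J V : finType) (iota : J -> I) :
  injective iota ->
  #|[set v : {ffun I -> V} | injectiveb (v \o iota)]|
  = #|V| ^_ #|J| * #|V| ^ (#|I| - #|J|).
Proof.
move=> iota_inj.
pose res (v : {ffun I -> V}) : {ffun J -> V} := [ffun x => v (iota x)].
rewrite -sum1dep_card.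
rewrite (partition_big res (fun u => injectiveb u)) /=; last first.
  move=> v /injectiveP injv; apply/injectiveP => x y.
  by rewrite !ffunE => /(injv x y).
rewrite (eq_bigr (fun _ => #|V| ^ (#|I| - #|J|))).
  by rewrite sum_nat_const -cardsE card_inj_ffuns.
move=> u /injectiveP inju; rewrite sum1dep_card.
(* Allowed values at [i] once the restriction [u] is fixed: one value on the image of [iota], any
   value elsewhere. *)
pose A i := if [pick x | iota x == i] is Some x then [set u x] else [set: V].
have A_iota x : A (iota x) = [set u x].
  rewrite /A; case: pickP => [y /eqP/iota_inj-> //|/(_ x)].
  by rewrite eqxx.
transitivity #|[set v : {ffun I -> V} | [forall i, v i \in A i]]|.
  apply: eq_card => v; rewrite !inE; apply/andP/forallP.
    case=> _ /eqP/ffunP eq_u i; rewrite /A; case: pickP => [x /eqP<-|_].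
      by rewrite inE -eq_u ffunE.
    by rewrite inE.
  move=> vA; have eq_u x : v (iota x) = u x.
    by have := vA (iota x); rewrite A_iota => /set1P.
  split; last by apply/eqP/ffunP => x; rewrite ffunE.
  by apply/injectiveP => x y; rewrite /= !eq_u => /inju.
rewrite card_dependent_family (bigID (mem (codom iota))) /=.
rewrite big1 ?mul1n; last first.
  by move=> _ /codomP[x ->]; rewrite A_iota cards1.
rewrite (eq_bigr (fun _ => #|V|)) => [|i i_out].
  rewrite prod_nat_const; congr (_ ^ _).
  by rewrite -(card_codom iota_inj) -(cardC (mem (codom iota))) addKn.
rewrite /A; case: pickP => [x /eqP def_i|_]; last by rewrite cardsT.
by rewrite -def_i codom_f in i_out.
Qed.

(** Adding a constant to all letters preserves injectivity along [iota], and exactly one of the p +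
    1 shifts of a word is prime. Weighting each word by its number of prime shifts and exchanging
    sums makes every shift contribute equally. *)
Lemma card_prime_word_inj_on (I J : finType) p (iota : J -> I) :
  #|I| = p.+2 -> injective iota ->
  p.+1 * #|[set v : {ffun I -> 'I_p.+1} |
            prime_word v & injectiveb (v \o iota)]|
  = p.+1 ^_ #|J| * p.+1 ^ (p.+2 - #|J|).
Proof.
move=> card_I iota_inj.
have := card_ffun_inj_on 'I_p.+1 iota_inj; rewrite card_ord card_I => <-.
pose sh (c : 'I_p.+1) (v : {ffun I -> 'I_p.+1}) : {ffun I -> 'I_p.+1} :=
  [ffun i => v i + c]%R.
have sh_inj c : injective (sh c).
  move=> v w /ffunP eq_vw; apply/ffunP => i.
  by have := eq_vw i; rewrite !ffunE => /GRing.addIr.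
rewrite -[RHS]sum1dep_card.
under eq_bigr => v _ do rewrite -(sum_prime_shift v card_I).
rewrite exchange_big /= -[X in X * _](card_ord p.+1) -sum_nat_const.
apply: eq_bigr => c _.
rewrite [RHS](reindex_inj (sh_inj c)) /= -sum1dep_card.
rewrite big_mkcond [RHS]big_mkcond.
apply: eq_bigr => v _ /=.
have -> : injectiveb (sh c v \o iota) = injectiveb (v \o iota).
  apply/injectiveP/injectiveP => injv x y /=; have := injv x y;
    rewrite /= !ffunE.
    by move=> inj_xy eq_xy; apply: inj_xy; rewrite eq_xy.
  by move=> inj_xy /GRing.addIr.
have -> : prime_word (fun i => sh c v i - c)%R = prime_word v.
  apply: eq_forallb => j; congr (_ < _); apply: eq_card => i.
  by rewrite !inE ffunE GRing.addrK.
by rewrite andbC; case: injectiveb; case: prime_word.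
Qed.

(** * Moving cycle systems to fixed positions *)

(** Enumerate [T] twice, as the image of [iota] and then its complement, and likewise for [f]; the
    permutation matches entries of equal rank. *)
Lemma perm_extension (J T : finType) (iota f : J -> T) :
  injective iota -> injective f -> {t : {perm T} | forall x, t (iota x) = f x}.
Proof.
move=> iota_inj f_inj.
pose s (g : J -> T) := codom g ++ enum [predC codom g].
have s_all g : injective g -> uniq (s g) /\ size (s g) = #|T|.
  move=> g_inj; split.
    rewrite cat_uniq enum_uniq map_inj_uniq ?enum_uniq //= andbT.
    by apply/hasPn => z; rewrite mem_enum inE.
  by rewrite size_cat -cardE size_codom -(card_codom g_inj) cardC.
have [U1 S1] := s_all _ iota_inj; have [U2 S2] := s_all _ f_inj.
have mem_s z : z \in s iota.
  by rewrite mem_cat mem_enum inE; case: (z \in _).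
have lt_ix z : index z (s iota) < size (s f) by rewrite S2 -S1 index_mem.
pose t z := nth z (s f) (index z (s iota)).
have t_inj : injective t.
  move=> y z; rewrite /t (set_nth_default z) // => /eqP.
  rewrite nth_uniq // => /eqP eq_ix.
  by rewrite -(nth_index z (mem_s y)) eq_ix nth_index.
exists (perm t_inj) => x; rewrite permE /t /s index_cat codom_f nth_cat.
have lt_x : index (iota x) (codom iota) < size (codom f).
  by rewrite size_codom -(size_codom iota) index_mem codom_f.
rewrite lt_x /codom /image_mem index_map // (nth_map x) ?index_mem ?mem_enum //.
by rewrite nth_index ?mem_enum.
Qed.

Lemma prime_word_perm (I : finType) p (v : I -> 'I_p.+1) (t : {perm I}) :
  prime_word (v \o t) = prime_word v.
Proof.
apply: eq_forallb => j; congr (_ < _).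
rewrite -[RHS](card_preimset _ (@perm_inj _ t)).
by apply: eq_card => i; rewrite !inE.
Qed.

(** For fixed [f], a permutation taking [iota] to [f] preserves primality and turns the constraint
    on [v] at [f x] into one at [iota x]. The array is then determined by [v]. *)
Lemma sum_card_prime_systems p (J : finType) (rho : J -> J)
    (iota : J -> 'I_p.+2) :
  injective rho -> injective iota ->
  \sum_(v : {ffun 'I_p.+2 -> 'I_p.+1} | prime_word v)
    #|[set f : {ffun J -> 'I_p.+2} | injectiveb f &&
        [forall x, widen_ord (leqnSn _) (v (f x)) == f (rho x)]]|
  = #|[set v : {ffun 'I_p.+2 -> 'I_p.+1} |
        prime_word v & injectiveb (v \o iota)]|.
Proof.
move=> rho_inj iota_inj.
pose emb (y : 'I_p.+1) : 'I_p.+2 := widen_ord (leqnSn _) y.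
have emb_inj : injective emb by move=> x y /(congr1 val) eq_xy; apply: val_inj.
pose sys (g : J -> 'I_p.+2) (f : {ffun J -> 'I_p.+2})
    (v : {ffun 'I_p.+2 -> 'I_p.+1}) :=
  [forall x, emb (v (g x)) == f (rho x)].
transitivity (\sum_(v : {ffun 'I_p.+2 -> 'I_p.+1} | prime_word v)
    \sum_(f : {ffun J -> 'I_p.+2} | injectiveb f) (sys f f v : nat)).
  apply: eq_bigr => v _; rewrite -sum1dep_card -big_mkcondr /=.
  by apply: eq_bigl => f.
rewrite exchange_big /=.
transitivity (\sum_(f : {ffun J -> 'I_p.+2} | injectiveb f)
    \sum_(v : {ffun 'I_p.+2 -> 'I_p.+1} | prime_word v) (sys iota f v : nat)).
  apply: eq_bigr => f /injectiveP f_inj.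
  have [t tE] := perm_extension iota_inj f_inj.
  pose h (v : {ffun 'I_p.+2 -> 'I_p.+1}) := [ffun i => v (t i)].
  have h_inj : injective h.
    move=> v w /ffunP eq_vw; apply/ffunP => i.
    by have := eq_vw (invF (@perm_inj _ t) i); rewrite !ffunE f_invF.
  rewrite [RHS](reindex_inj h_inj) /=; apply: eq_big => v.
    rewrite -(prime_word_perm v t); apply: eq_forallb => j; congr (_ < _).
    by apply: eq_card => i; rewrite !inE ffunE.
  by move=> _; congr (nat_of_bool _); apply: eq_forallb => x; rewrite ffunE tE.
rewrite exchange_big /= -sum1dep_card big_mkcondr /=.
apply: eq_bigr => v _.
(* The only array compatible with [v]; it is injective exactly when [v] is injective along
   [iota]. *)
pose f0 : {ffun J -> 'I_p.+2} := [ffun x => emb (v (iota (invF rho_inj x)))].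
have sysE f : sys iota f v = (f == f0).
  apply/forallP/eqP => [sys_f|-> x]; last by rewrite ffunE invF_f.
  by apply/ffunP => x; rewrite ffunE (eqP (sys_f _)) f_invF.
have -> : injectiveb (v \o iota) = injectiveb f0.
  apply/injectiveP/injectiveP => inj_v x y.
    by rewrite !ffunE => /emb_inj/inj_v/(can_inj (f_invF rho_inj)).
  move=> /= eq_xy; apply: (rho_inj); apply: inj_v.
  by rewrite !ffunE !invF_f eq_xy.
rewrite (eq_bigr (fun f => if f == f0 then 1 else 0)); last first.
  by move=> f _; rewrite sysE; case: eqP.
rewrite -big_mkcondr; case: ifP => inj_f0.
  rewrite (big_pred1 f0) // => f /=.
  by case: (f =P f0) => [->|_]; rewrite ?inj_f0 ?andbF.
rewrite big_pred0 // => f.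
by case: (f =P f0) => [->|_]; rewrite ?inj_f0 ?andbF.
Qed.

(** * Factorial moments of the number of m-cycles *)

Lemma sum_ffact_num_mcycles p m s : 0 < m ->
  p.+1 * (\sum_(v : {ffun 'I_p.+2 -> 'I_p.+1} | prime_word v)
            num_mcycles m (fun i => (v i).+1) ^_ s * m ^ s)
  = p.+1 ^_ (s * m) * p.+1 ^ (p.+2 - s * m).
Proof.
move=> m_gt0; set J : finType := ('I_s * 'I_m)%type.
have card_J : #|J| = s * m by rewrite card_prod !card_ord.
pose F (v : {ffun 'I_p.+2 -> 'I_p.+1}) i : 'I_p.+2 :=
  widen_ord (leqnSn _) (v i).
rewrite (eq_bigr (fun v => #|[set f : {ffun J -> 'I_p.+2} |
    injectiveb f && [forall x, F v (f x) == f (x.1, ordS x.2)]]|)); last first.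
  by move=> v _; rewrite card_cycle_systems.
(* Fixed positions exist only if [J] fits into ['I_p.+2]; otherwise no array is injective and both
   sides vanish. *)
have [le_J|gt_J] := leqP #|J| p.+2; last first.
  rewrite big1 ?muln0 => [|v _].
    by rewrite ffact_small // -card_J ltnW.
  apply: eq_card0 => f; rewrite inE; apply/negP => /andP[/injectiveP f_inj _].
  by have := leq_card f f_inj; rewrite card_ord leqNgt gt_J.
pose iota x : 'I_p.+2 := widen_ord le_J (enum_rank x).
have iota_inj : injective iota.
  by move=> x y /(congr1 val) eq_xy; apply: enum_rank_inj; apply: val_inj.
have rho_inj : injective (fun x : J => (x.1, ordS x.2) : J).
  move=> [a1 b1] [a2 b2] [-> eq_b]; congr (_, _).
  by apply: ordS_inj; apply: val_inj.
rewrite (sum_card_prime_systems rho_inj iota_inj).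
by rewrite card_prime_word_inj_on ?card_ord // card_J.
Qed.

(** In the moment identity with s = c, the right side vanishes if cm > p + 1, while [v] alone
    contributes c! m^c > 0 to the left. *)
Lemma leq_num_mcycles p m (v : {ffun 'I_p.+2 -> 'I_p.+1}) :
  0 < m -> prime_word v -> num_mcycles m (fun i => (v i).+1) * m <= p.+1.
Proof.
move=> m_gt0 v_prime; set c := num_mcycles _ _.
rewrite leqNgt; apply/negP => lt_p.
have := sum_ffact_num_mcycles p c m_gt0.
rewrite (ffact_small lt_p) mul0n (bigD1 v) //= -/c ffactnn.
have := fact_gt0 c; have : 0 < m ^ c by rewrite expn_gt0 m_gt0.
by case: (m ^ c) => // a; case: (c`!).
Qed.

(** * From prime parking functions to prime words *)

(** An entry of the sorted sequence at index i is at most i + 1 once more than i values are, so the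
    counts yield [parking]. *)
Lemma prime_parkingP p (pi : 'I_p.+2 -> nat) :
  reflect ((forall i, 0 < pi i) /\
           forall j : 'I_p.+1, j.+1 < #|[set i | pi i <= j.+1]|)
    (prime_parking pi).
Proof.
apply: (iffP andP) => [[/andP[/forallP pi_gt0 _] /forallP pi_prime]|].
  split=> // j; have lt_j : j.+1 < p.+2 by rewrite ltnS.
  by have := pi_prime (Ordinal lt_j).
case=> pi_gt0 pi_prime; split; last first.
  apply/forallP => -[[|j] lt_j] //=.
  exact: (pi_prime (Ordinal (lt_j : j < p.+1))).
apply/andP; split; first exact/forallP.
apply/forallP => i; set s := [seq pi j | j : 'I_p.+2].
have count_s x : count (leq^~ x) s = #|[set i | pi i <= x]|.
  rewrite cardsE cardE /enum_mem -enumT size_filter count_map.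
  by apply: eq_count => j; rewrite inE.
have : i < count (leq^~ i.+1) (sort leq s).
  rewrite count_sort count_s.
  have [lt_i|ge_i] := ltnP i p.+1.
    by apply: ltnW (pi_prime (Ordinal lt_i)).
  (* At the last index i = p + 1 the count at level p + 1 is used: it exceeds p + 1. *)
  have lt_ip : i < #|[set j | pi j <= p.+1]|.
    by apply: leq_ltn_trans (pi_prime ord_max); rewrite -ltnS.
  apply: leq_trans lt_ip _; apply: subset_leq_card.
  apply/subsetP => j; rewrite !inE => /leq_trans; apply.
  exact: leqW.
have sorted_s : sorted leq (sort leq s) by apply: sort_sorted; apply: leq_total.
move=> lt_i; apply: (@Order.POrderTheory.nth_count_le _ nat i.+1 0 _ i).
  exact: sorted_s.
exact: lt_i.
Qed.

Lemma eq_prime_parking p (pi pi' : 'I_p.+2 -> nat) :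
  pi =1 pi' -> prime_parking pi = prime_parking pi'.
Proof.
move=> eq_pi; apply/prime_parkingP/prime_parkingP => -[pi_gt0 pi_prime].
  split=> [i|j]; first by rewrite -eq_pi.
  suff -> : [set i | pi' i <= j.+1] = [set i | pi i <= j.+1] by [].
  by apply/setP => i; rewrite !inE eq_pi.
split=> [i|j]; first by rewrite eq_pi.
suff -> : [set i | pi i <= j.+1] = [set i | pi' i <= j.+1] by [].
by apply/setP => i; rewrite !inE eq_pi.
Qed.

Lemma prime_parking_succ p (v : 'I_p.+2 -> 'I_p.+1) :
  prime_parking (fun i => (v i).+1) = prime_word v.
Proof.
apply/prime_parkingP/forallP => [[_ v_prime] j|v_prime]; last by split.
exact: v_prime.
Qed.

(** At level p + 1 the count exceeds p + 1, so it includes all p + 2 positions. *)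
Lemma prime_parking_leq p (pi : 'I_p.+2 -> nat) i :
  prime_parking pi -> 0 < pi i <= p.+1.
Proof.
case/prime_parkingP => -> /(_ ord_max) /=.
rewrite -[X in X <= _](card_ord p.+2) => le_card.
have /eqP eqT : [set i | pi i <= p.+1] == setT.
  by rewrite eqEcard subsetT cardsT.
by have : i \in [set i | pi i <= p.+1]; [rewrite eqT | rewrite inE].
Qed.

Lemma card_prime_parking_with_mcycles p m k :
  #|prime_parking_with_mcycles p.+2 m k| =
  \sum_(v : {ffun 'I_p.+2 -> 'I_p.+1} | prime_word v)
    (num_mcycles m (fun i => (v i).+1) == k).
Proof.
(* [lift ord0] adds one, so [h] is the shift from words to parking functions. *)
pose h (v : {ffun 'I_p.+2 -> 'I_p.+1}) : {ffun 'I_p.+2 -> 'I_p.+3} :=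
  [ffun i => lift ord0 (widen_ord (leqnSn _) (v i))].
have hE v i : h v i = (v i).+1 :> nat by rewrite ffunE.
have h_inj : injective h.
  move=> v w /ffunP eq_vw; apply/ffunP => i; apply: val_inj.
  by have := congr1 val (eq_vw i); rewrite /= !hE => -[].
rewrite -big_mkcondr /= sum1dep_card -(card_imset _ h_inj).
apply: eq_card => pi; rewrite inE; apply/andP/imsetP.
  case=> pi_prime /eqP pi_k.
  have le_pi i : 0 < pi i <= p.+1 by exact: (prime_parking_leq i pi_prime).
  have pi_lt i : (pi i).-1 < p.+1 by have := le_pi i; case: (pi i : nat).
  pose v : {ffun 'I_p.+2 -> 'I_p.+1} := [ffun i => Ordinal (pi_lt i)].
  have piE i : (v i).+1 = pi i.
    by rewrite ffunE /= prednK //; case/andP: (le_pi i).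
  exists v; last by apply/ffunP => i; apply: val_inj; rewrite /= hE piE.
  rewrite inE -prime_parking_succ (eq_prime_parking piE).
  by rewrite (eq_num_mcycles _ piE) pi_k eqxx andbT.
case=> v; rewrite inE => /andP[v_prime /eqP v_k] ->.
rewrite (eq_prime_parking (hE v)) prime_parking_succ.
by rewrite (eq_num_mcycles _ (hE v)) v_k.
Qed.

(** * Binomial moments and inversion *)

Lemma sum_binomial_num_mcycles p m s : 0 < m -> s * m <= p.+1 ->
  (\sum_(v : {ffun 'I_p.+2 -> 'I_p.+1} | prime_word v)
     'C(num_mcycles m (fun i => (v i).+1), s))
    * (s`! * m ^ s * (p.+1 - s * m)`!)
  = p.+1`! * p.+1 ^ (p.+1 - s * m).
Proof.
move=> m_gt0 le_sm; set S := \sum_(v | _) _.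
have := sum_ffact_num_mcycles p s m_gt0; rewrite subSn // expnS.
have -> : \sum_(v : {ffun 'I_p.+2 -> 'I_p.+1} | prime_word v)
    num_mcycles m (fun i => (v i).+1) ^_ s * m ^ s = S * (s`! * m ^ s).
  by rewrite big_distrl /=; apply: eq_bigr => v _; rewrite mulnA bin_ffact.
rewrite -(ffact_fact le_sm) mulnA => /(congr1 (muln (p.+1 - s * m)`!)) S_eq.
by apply/eqP; rewrite -(eqn_pmul2l (ltn0Sn p)); apply/eqP; lia.
Qed.

(** Choosing k + l of c objects and marking k of them is choosing the k marked ones first, then l of
    the rest. *)
Lemma bin_bin c k l : 'C(k + l, k) * 'C(c, k + l) = 'C(c, k) * 'C(c - k, l).
Proof.
have [le_kl|gt_kl] := leqP (k + l) c; last first.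
  rewrite [in LHS](bin_small gt_kl) muln0; have [le_k|gt_k] := leqP k c.
    by rewrite (@bin_small (c - k)) ?muln0 // ltn_subLR.
  by rewrite bin_small.
have le_k : k <= c by apply: leq_trans le_kl; apply: leq_addr.
have le_l : l <= c - k by rewrite leq_subRL.
have pos : 0 < k`! * l`! * (c - k - l)`! by rewrite !muln_gt0 !fact_gt0.
apply/eqP; rewrite -(eqn_pmul2r pos).
have := bin_fact (leq_addr l k); rewrite addKn => fact_kl.
have := bin_fact le_kl; rewrite subnDA => fact_c.
have := bin_fact le_k; have := bin_fact le_l; nia.
Qed.

Section RationalIdentities.
Import GRing.Theory Num.Theory.
Local Open Scope ring_scope.

Lemma sum_alt_binomial (R : comRingType) d n : (d < n)%N ->
  \sum_(l < n) (-1) ^+ l * ('C(d, l))%:R = (d == 0%N)%:R :> R.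
Proof.
move=> lt_dn; transitivity ((1 - 1 : R) ^+ d); last by rewrite subrr expr0n.
rewrite exprBn (big_ord_widen n
  (fun i => ((-1) ^+ i * 1 ^+ (d - i) * 1 ^+ i) *+ 'C(d, i))) //.
rewrite [RHS]big_mkcond; apply: eq_bigr => l _; rewrite !expr1n !mulr1 mulr_natr.
by case: ifP => // /negbT; rewrite -leqNgt => /bin_small->; rewrite mulr0n.
Qed.

(** By [bin_bin] the factor C(c, k) comes out, leaving the expansion of (1 - 1)^(c-k); it vanishes
    unless c <= k, and C(c, k) vanishes for c < k. *)
Lemma binomial_inversion_indicator (R : comRingType) c k n :
  (c - k < n)%N ->
  (c == k)%:R = \sum_(l < n) (-1) ^+ l * ('C(k + l, k) * 'C(c, k + l))%:R :> R.
Proof.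
move=> lt_c; under eq_bigr => l _ do rewrite bin_bin natrM mulrCA.
rewrite -mulr_sumr sum_alt_binomial //.
have [lt_ck|gt_ck|->] := ltngtP c k.
- by rewrite bin_small ?mul0r.
- by rewrite subn_eq0 leqNgt gt_ck mulr0.
by rewrite subnn binn mulr1.
Qed.

Lemma multinomial_nseq s m r :
  multinomial (rcons (nseq s m) r) = (s * m + r)`!%:R / (m`! ^ s * r`!)%:R.
Proof.
rewrite /multinomial -cats1 sumn_cat sumn_nseq /= addn0 mulnC.
by rewrite big_cat big_nseq big_seq1 /= iter_muln_1.
Qed.

Lemma card_prime_parking_with_mcycles_sum p m k :
  (0 < m)%N ->
  #|prime_parking_with_mcycles p.+2 m k|%:R =
  \sum_(l < p.+2 | ((k + l) * m <= p.+1)%N)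
    (-1) ^+ l * (((m - 1)`! ^ (k + l))%N%:R / (k`! * l`!)%N%:R)
    * multinomial (rcons (nseq (k + l) m) (p.+1 - (k + l) * m)%N)
    * p.+1%:R ^+ (p.+1 - (k + l) * m)%N :> rat.
Proof.
move=> m_gt0; rewrite card_prime_parking_with_mcycles natr_sum.
pose c (v : {ffun 'I_p.+2 -> 'I_p.+1}) := num_mcycles m (fun i => (v i).+1).
have le_c (v : {ffun 'I_p.+2 -> 'I_p.+1}) :
  prime_word v -> (c v * m <= p.+1)%N by apply: leq_num_mcycles.
rewrite (eq_bigr (fun v => \sum_(l < p.+2)
    (-1) ^+ l * ('C(k + l, k) * 'C(c v, k + l))%:R)) => [|v v_prime]; last first.
  (* The range l < p + 2 suffices because c <= cm <= p + 1. *)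
  apply: binomial_inversion_indicator; rewrite ltnS (leq_trans (leq_subr _ _)) //.
  by rewrite (leq_trans _ (le_c v v_prime)) // leq_pmulr.
rewrite exchange_big /= [RHS]big_mkcond.
apply: eq_bigr => l _; rewrite -mulr_sumr -natr_sum -big_distrr /=.
set s := (k + l)%N; case: leqP => [le_sm|gt_sm]; last first.
  (* Terms with (k+l)m > p + 1 vanish: no prime word has k + l cycles. *)
  rewrite [X in (_ * X)%N]big1 ?muln0 ?mulr0 // => v v_prime.
  apply: bin_small; rewrite -(ltn_pmul2r m_gt0).
  exact: leq_ltn_trans (le_c v v_prime) gt_sm.
rewrite multinomial_nseq subnKC // -!mulrA; congr (_ * _).
have := sum_binomial_num_mcycles m_gt0 le_sm.
set S := (\sum_(v | _) _)%N => S_eq.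
have := bin_fact (leq_addr l k); rewrite -/s addKn => C_eq.
(* This trades the m^s of base points for the ratio of (m!)^s to ((m-1)!)^s in the stated
   formula. *)
have m_fact : (m`! = m * (m - 1)`!)%N.
  by rewrite subn1; case: (m) m_gt0 => // m' _; rewrite factS.
rewrite m_fact expnMn; set X := ((m - 1)`! ^ s)%N.
have X_neq0 : X%:R != 0 :> rat by rewrite pnatr_eq0 -lt0n expn_gt0 fact_gt0.
set K := (k`! * l`!)%N in C_eq *.
have K_neq0 : K%:R != 0 :> rat.
  by rewrite pnatr_eq0 -lt0n muln_gt0 !fact_gt0.
set D := (m ^ s * (p.+1 - s * m)`!)%N.
have D_neq0 : D%:R != 0 :> rat.
  by rewrite pnatr_eq0 -lt0n muln_gt0 expn_gt0 m_gt0 fact_gt0.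
have num_eq : (p.+1)`!%:R * p.+1%:R ^+ (p.+1 - s * m)
    = 'C(s, k)%:R * S%:R * K%:R * D%:R :> rat.
  by rewrite -natrX -!natrM -S_eq -C_eq; congr _%:R; rewrite /D; lia.
rewrite mulnAC -/D (natrM _ D) (natrM _ _ S) [_^-1 * p.+1%:R ^+ _]mulrC.
rewrite (mulrA (p.+1)`!%:R) num_eq; field.
by rewrite X_neq0 D_neq0 K_neq0.
Qed.

End RationalIdentities.

Theorem theorem3p3 (n m k : nat) (hn : 2 <= n) (hm : 1 <= m)
    (hkm : k * m <= n - 1) :
  ((#|prime_parking_with_mcycles n m k|)%:R =
   \sum_(0 <= l < n | ((k + l) * m <= n - 1)%N)
     (-1) ^+ l * ((((m - 1)`! ^ (k + l))%N)%:R / (k`! * l`!)%N%:R)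
     * multinomial (rcons (nseq (k + l) m) (n - (k + l) * m - 1)%N)
     * (n - 1)%N%:R ^+ (n - (k + l) * m - 1)%N :> rat)%R.
Proof.
case: n hn hkm => [//|[//|p]] _ _.
rewrite card_prime_parking_with_mcycles_sum // subn1 big_mkord.
by apply: eq_bigr => l _; rewrite subnAC subn1.
Qed.
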